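(* (i) For every integer $k\ge 3$, neither $\mathcal A_k$ nor $\mathcal R_k$ is polynomially $\tau$-bounded. (ii) Moreover, for every $k\ge 3$ and every integer $g\ge1$, neither the class of connected graphs $H\in\mathcal A_k$ with $\operatorname{girth}(U(H))>g$ nor the class of connected graphs $H\in\mathcal R_k$ with $\operatorname{girth}(U(H))>g$ is polynomially $\tau$-bounded. (iii) If $F$ is an acyclic oriented graph and $U(F)$ contains a cycle, then the class of $F$-free acyclic oriented graphs is not polynomially $\tau$-bounded.
   Context: All graphs and digraphs are finite. An oriented graph is a loopless digraph with no pair of opposite arcs (and no parallel arcs); it is acyclic if it has no directed cycle. $U(H)$ denotes the underlying simple undirected graph of $H$; $H$ is connected if $U(H)$ is connected. The girth of a graph is the length of a shortest cycle ($\infty$ for a forest). A tournament is an orientation of a complete graph. A homomorphism is a vertex map preserving every arc. $H$ is $F$-free if no (not necessarily induced) subgraph of $H$ is isomorphic to $F$. For a nonempty acyclic oriented graph $H$, $p(H)$ is the maximum number of vertices on a directed path in $H$. The compressibility $\tau(H)$ is the least positive integer $n$ such that $H$ admits a homomorphism to every tournament of order $n$. A class of acyclic oriented graphs is polynomially $\tau$-bounded if there are constants $c,d>0$ (depending only on the class) such that $\tau(H)\le c\,p(H)^d$ for every nonempty graph $H$ in the class. Two vertices are linked if they are the endpoints of a directed path of length at most two, in either direction. A relative oriented clique of $H$ is a set of vertices that are pairwise linked in $H$; $\omega_{\mathrm{ro}}(H)$ is its maximum order. An oriented clique is an oriented graph in which every two vertices are linked within that graph; $\omega_{\mathrm{ao}}(H)$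 is the maximum order of an oriented clique that is a subgraph of $H$. For $k\ge3$, $$\mathcal A_k=\{H: H\text{ is an acyclic oriented graph with }\omega_{\mathrm{ao}}(H)\le k\},\quad \mathcal R_k=\{H: H\text{ is an acyclic oriented graph with }\omega_{\mathrm{ro}}(H)\le k\}.$$ *)

(* Defs.v *)
From mathcomp Require Import all_boot all_order all_algebra.
From mathcomp Require Import reals exp.

Set Implicit Arguments.
Unset Strict Implicit.
Unset Printing Implicit Defensive.

Import Order.TTheory GRing.Theory Num.Theory.

Record digraph := Digraph { vertex :> finType; arc : rel vertex }.

Definition oriented (H : digraph) : bool :=
  [forall x : H, ~~ arc x x] &&
  [forall x : H, forall y : H, arc x y ==> ~~ arc y x].

Definition acyclic (H : digraph) : Prop :=
  forall s : seq H, ucycle (@arc H) s -> s = [::].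

Definition acyclic_oriented (H : digraph) : Prop := oriented H /\ acyclic H.

(* The adjacency relation of U(H). *)
Definition und (H : digraph) : rel H := [rel x y | arc x y || arc y x].

Definition connected (H : digraph) : Prop :=
  forall x y : H, connect (@und H) x y.

(* [e] is meant to be symmetric and irreflexive; the bound on the size of [s]
   excludes an edge traversed back and forth. *)
Definition graph_cycle (T : finType) (e : rel T) (s : seq T) : bool :=
  (2 < size s) && ucycleb e s.

(* [None] stands for infinity.  A cycle has at most #|T| vertices, so the
   enumeration, which is increasing, meets all cycle lengths. *)
Definition girth (T : finType) (e : rel T) : option nat :=
  ohead [seq n <- iota 0 #|T|.+1 | [exists s : n.-tuple T, graph_cycle e s]].

Definition girth_gt (T : finType) (e : rel T) (g : nat) : bool :=
  if girth e is Some n then g < n else true.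

Definition tournament (G : digraph) : bool :=
  [forall x : G, ~~ arc x x] &&
  [forall x : G, forall y : G, (x != y) ==> (arc x y (+) arc y x)].

Definition homomorphism (H G : digraph) (f : H -> G) : Prop :=
  forall x y : H, arc x y -> arc (f x) (f y).

Definition isomorphic (H G : digraph) : Prop :=
  exists f : H -> G, bijective f /\ forall x y : H, arc (f x) (f y) = arc x y.

(* A (not necessarily induced) subgraph of H is given by a vertex set S and a
   set A of arcs of H with both endpoints in S. *)
Definition subgraph (H : digraph) (S : {set H}) (A : {set H * H}) : bool :=
  [forall a in A, [&& arc a.1 a.2, a.1 \in S & a.2 \in S]].

Definition subdigraph (H : digraph) (S : {set H}) (A : {set H * H}) : digraph :=
  @Digraph {x : H | x \in S} [rel x y | (val x, val y) \in A].

Definition free (F H : digraph) : Prop :=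
  forall (S : {set H}) (A : {set H * H}),
    subgraph S A -> ~ isomorphic F (subdigraph S A).

(* p(H), counted in vertices; a path has at most #|H| of them. *)
Definition maxpath (H : digraph) : nat :=
  \max_(n < #|H|.+1 |
        [exists s : n.-tuple H, uniq s && sorted (@arc H) s]) n.

Definition maps_to_tournaments (H : digraph) (n : nat) : Prop :=
  forall G : digraph, tournament G -> #|G| = n ->
    exists f : H -> G, homomorphism f.

(* The compressibility of H is n.  It exists (and is unique) for every acyclic
   oriented H, since large tournaments contain large transitive ones. *)
Definition is_compressibility (H : digraph) (n : nat) : Prop :=
  [/\ 0 < n, maps_to_tournaments H n
    & forall m, 0 < m -> maps_to_tournaments H m -> n <= m].

Definition poly_tau_bounded (R : realType) (C : digraph -> Prop) : Prop :=
  exists c d : R, [/\ (0 < c)%R, (0 < d)%R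
    & forall H : digraph, C H -> 0 < #|H| ->
      forall n, is_compressibility H n ->
        (n%:R <= c * powR (maxpath H)%:R d)%R].

(* In a loopless digraph, a walk of length two between distinct vertices is a
   path. *)
Definition linked (H : digraph) (x y : H) : bool :=
  [|| arc x y, arc y x,
      [exists z : H, arc x z && arc z y] | [exists z : H, arc y z && arc z x]].

Definition rel_oriented_clique (H : digraph) (S : {set H}) : bool :=
  [forall x in S, forall y in S, (x != y) ==> linked x y].

Definition omega_ro (H : digraph) : nat :=
  \max_(S : {set H} | rel_oriented_clique S) #|S|.

Definition oriented_clique (G : digraph) : bool :=
  oriented G && [forall x : G, forall y : G, (x != y) ==> linked x y].

Definition omega_ao (H : digraph) : nat :=
  \max_(S : {set H} | [exists A : {set H * H},
          subgraph S A && oriented_clique (subdigraph S A)]) #|S|.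

Definition class_A (k : nat) (H : digraph) : Prop :=
  acyclic_oriented H /\ omega_ao H <= k.

Definition class_R (k : nat) (H : digraph) : Prop :=
  acyclic_oriented H /\ omega_ro H <= k.

Definition connected_girth_gt (g : nat) (C : digraph -> Prop) (H : digraph) :
  Prop := [/\ C H, connected H & girth_gt (@und H) g].

Definition free_class (F H : digraph) : Prop := acyclic_oriented H /\ free F H.

(* Main.v *)
Require Import Defs.
From mathcomp Require Import all_boot all_order all_algebra.
From mathcomp Require Import boolp reals exp.
From mathcomp Require Import zify.
Import Order.TTheory GRing.Theory Num.Theory.
(* Again, since path.v also defines [arc]. *)
Import Defs.

Set Implicit Arguments.
Unset Strict Implicit.
Unset Printing Implicit Defensive.

(* A random tournament shows that some tournament T of order 2^q contains no
   transitive subtournament of order p = 2q+2.  Following Erdos, a random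
   sequence of O(|V|) pairs of vertices, from which the O(1) vertices on short
   cycles are removed, gives a graph of large girth on V = [p] x [n] in which any
   two sets of linear size are joined.  Orient its edges between different levels
   upwards.  A homomorphism f to T is constant on a linear part of each level;
   these p values would span a transitive subtournament of T.  So some component
   H of this digraph has no homomorphism to T, whence tau(H) > 2^q while
   p(H) <= 2q+2.  Girth above 6 forces omega_ro(H) <= 3, and girth above |F|
   makes H F-free. *)

(** * Counting and averaging on finite types *)

(** In probabilistic terms, prescribing a uniform random function on [D] costs a factor
    [#|B| ^ #|D|]. Probabilities are cleared of denominators throughout, to stay in [nat]. *)
Lemma card_agree (A B : finType) (D : {set A}) (F : {set {ffun A -> B}}) :
  (forall f f', f \in F -> f' \in F -> forall x, x \in D -> f x = f' x) ->
  #|F| * #|B| ^ #|D| <= #|B| ^ #|A|.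
Proof.
move=> agree; have [-> | [h hF]] := set_0Vmem F; first by rewrite cards0.
pose G x : pred B := if x \in D then pred1 (h x) else predT.
have sub : #|F| <= #|family G|.
  apply/subset_leq_card/subsetP => f fF; apply/familyP => x.
  by rewrite /G; case: ifP => // xD; rewrite inE (agree f h).
have cardG : #|family G| = #|B| ^ #|~: D|.
  rewrite card_family foldrE big_map big_enum /= -prod_nat_const.
  rewrite [RHS]big_mkcond /=; apply: eq_bigr => x _.
  by rewrite /G inE; case: ifP => _; rewrite ?card1.
apply: leq_trans (leq_mul sub (leqnn _)) _.
by rewrite cardG -expnD addnC cardsC.
Qed.

Lemma pigeonhole (V T : finType) (f : V -> T) (S : {set V}) :
  0 < #|T| -> exists t, #|S| <= #|T| * #|[set x in S | f x == t]|.
Proof.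
move=> /card_gt0P[t0 _].
pose c t := #|[set x in S | f x == t]|.
exists [arg max_(t > t0) c t]; case: arg_maxnP => // t _ tmax.
rewrite -sum1_card (partition_big f xpredT) //= -sum_nat_const.
apply: leq_sum => u _; apply: leq_trans (tmax u isT).
by rewrite /c -sum1_card; under [X in _ <= X]eq_bigl => x do rewrite inE.
Qed.

Lemma averaging (T : finType) (w : T -> nat) c :
  \sum_x w x < c * #|T| -> exists x, w x < c.
Proof.
move=> sum_lt; apply/existsP/contraT => /existsPn w_ge; move: sum_lt.
rewrite mulnC -sum_nat_const ltnNge leq_sum // => x _.
by rewrite leqNgt.
Qed.

(** Linearity of expectation, in the form that [averaging] consumes. *)
Lemma double_count (S T : finType) (P : pred T) (r : S -> T -> bool) :
  \sum_x \sum_(t | P t) r x t = \sum_(t | P t) #|[set x | r x t]|.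
Proof.
rewrite exchange_big /=; apply: eq_bigr => t _.
rewrite -sum1_card [RHS]big_mkcond; apply: eq_bigr => x _.
by rewrite inE; case: (r x t).
Qed.

(** * Random tournaments without large transitive subtournaments *)

(* Indexing the random bits by unordered pairs makes a uniform [w] a uniform
   tournament; the order of 'I_N is the reference orientation. *)
Definition random_tournament N (w : {ffun {set 'I_N} -> bool}) : digraph :=
  @Digraph 'I_N [rel x y | (x != y) && (w [set x; y] (+) (x < y))].

Lemma random_tournamentP N (w : {ffun {set 'I_N} -> bool}) :
  tournament (random_tournament w).
Proof.
apply/andP; split; first by apply/forallP => x /=; rewrite eqxx.
apply/forallP => x; apply/forallP => y; apply/implyP => /= xy.
rewrite xy eq_sym xy /= [[set y; x]]setUC.
have : (x < y) (+) (y < x).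
  by move: xy; rewrite -(inj_eq val_inj) /=; case: ltngtP.
by case: (w _); case: (x < y); case: (y < x).
Qed.

(** First moment: each of the [2 ^ (q * p)] sequences of length [p = 2q+2] is transitive with
    probability at most 1 over [2 ^ 'C(p, 2)], and [q * p < 'C(p, 2)]. *)
Lemma tournament_without_transitive (q : nat) :
  exists T : digraph, [/\ tournament T, #|T| = 2 ^ q &
    forall t : 'I_(q.+1.*2) -> T,
      ~ forall i j : 'I_(q.+1.*2), i < j -> arc (t i) (t j)].
Proof.
set p := q.+1.*2; pose N := 2 ^ q.
pose W := {ffun {set 'I_N} -> bool}.
pose trans (w : W) (t : {ffun 'I_p -> 'I_N}) :=
  [forall i : 'I_p, forall j : 'I_p, (i < j) ==>
     @arc (random_tournament w) (t i) (t j)].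
pose F t := [set w | trans w t].
have FP t w (i j : 'I_p) : w \in F t -> i < j -> @arc (random_tournament w) (t i) (t j).
  by rewrite inE => /forallP/(_ i)/forallP/(_ j)/implyP.
have cardF t : #|F t| * 2 ^ 'C(p, 2) <= #|{: W}|.
  have [-> | [w0 w0F]] := set_0Vmem (F t); first by rewrite cards0.
  (* There are no loops, so a transitive sequence has distinct terms; it fixes the bits of
     ['C(p, 2)] different pairs. *)
  have inj_t : injective t.
    move=> i j tij; apply: val_inj; apply/eqP; rewrite eqn_leq leqNgt (leqNgt j).
    by apply/andP; split; apply/negP => /(FP t w0 _ _ w0F); rewrite /= tij eqxx.
  pose D := [set A : {set 'I_N} | A \subset t @: 'I_p & #|A| == 2].
  have cardD : #|D| = 'C(p, 2) by rewrite cards_draws card_imset ?card_ord.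
  have := @card_agree _ bool D (F t).
  rewrite card_bool cardD card_ffun card_bool; apply=> w w' wF w'F A.
    rewrite inE => /andP[/subsetP sA /cards2P[x [y [xy defA]]]].
  have [|i _ xi] := imsetP (sA x _); first by rewrite defA !inE eqxx.
  have [|j _ yj] := imsetP (sA y _); first by rewrite defA !inE eqxx orbT.
  have {}defA : A = [set t i; t j] by rewrite defA xi yj.
  have {xy} : i != j by apply: contra xy => /eqP ij; rewrite xi yj ij.
  rewrite -(inj_eq val_inj) /= neq_ltn => /orP[] ij.
    have /andP[_] := FP _ _ _ _ wF ij; have /andP[_] := FP _ _ _ _ w'F ij.
    by rewrite defA; case: (w _); case: (w' _); case: (_ < _).
  have /andP[_] := FP _ _ _ _ wF ij; have /andP[_] := FP _ _ _ _ w'F ij.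
  by rewrite defA setUC; case: (w _); case: (w' _); case: (_ < _).
have [w] : exists w : W, \sum_t trans w t < 1.
  apply: averaging; rewrite double_count mul1n.
  rewrite -(ltn_pmul2r (expn_gt0 2 'C(p, 2))) big_distrl /=.
  apply: leq_ltn_trans (leq_sum _ (fun t _ => cardF t)) _.
  rewrite sum_nat_const card_ffun !card_ord mulnC ltn_pmul2l; last first.
    by apply/card_gt0P; exists [ffun=> true].
  rewrite -expnM ltn_exp2l // bin2 /p; nia.
rewrite ltnS leqn0 sum_nat_eq0 => /forallP w0.
exists (random_tournament w); split; first exact: random_tournamentP.
  by rewrite card_ord.
move=> t tt; have := w0 (finfun t); rewrite eqb0 => /negP[].
apply/forallP => i; apply/forallP => j; apply/implyP => ij.
by rewrite !ffunE; apply: tt.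
Qed.

(** * Random edge sequences and sparse graphs *)

(* [x.1] lists the vertices of the cycle; [x.2 j] says which term of the random
   sequence [w] is its [j]-th edge, and in which direction. *)
Definition traces_cycle (V : finType) M l (w : {ffun 'I_M -> V * V})
    (x : {ffun 'I_l -> V} * {ffun 'I_l -> 'I_M * bool}) : bool :=
  [&& 2 < l, injectiveb x.1 & [forall j, w (x.2 j).1 ==
    if (x.2 j).2 then (x.1 j, x.1 (ordS j)) else (x.1 (ordS j), x.1 j)]].

Lemma ordS2_neq l (j : 'I_l) : 2 < l -> ordS (ordS j) <> j.
Proof.
move=> l_gt2 /(congr1 val) /=; have := ltn_ord j => jl.
case: (ltnP j.+1 l) => [j1 | l_le].
  rewrite (modn_small j1); case: (ltnP j.+2 l) => [j2 | l_le].
    by rewrite modn_small; lia.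
  by rewrite (_ : j.+2 = l) ?modnn; lia.
by rewrite (_ : j.+1 = l) ?modnn ?modn_small; lia.
Qed.

(** If edges [i] and [j] use the same term, equal directions give [i = j]; opposite directions make
    each the successor of the other, which needs length at most two. *)
Lemma traces_cycle_inj (V : finType) M l (w : {ffun 'I_M -> V * V})
    (x : {ffun 'I_l -> V} * {ffun 'I_l -> 'I_M * bool}) :
  traces_cycle w x -> injective (fun j => (x.2 j).1).
Proof.
case/and3P=> l_gt2 /injectiveP v_inj /forallP wx i j /= uij.
have := eqP (wx i); have := eqP (wx j); rewrite uij => ->.
case: (x.2 i).2; case: (x.2 j).2 => -[] /v_inj e1 /v_inj e2 //.
  by case: (@ordS2_neq _ j); rewrite // e1 e2.
by case: (@ordS2_neq _ j); rewrite // e2 e1.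
Qed.

Lemma card_traces_cycle (V : finType) M l
    (x : {ffun 'I_l -> V} * {ffun 'I_l -> 'I_M * bool}) :
  #|[set w : {ffun 'I_M -> V * V} | traces_cycle w x]| * (#|V| * #|V|) ^ l
    <= (#|V| * #|V|) ^ M.
Proof.
set F := [set w | _]; have [-> | [w0 w0F]] := set_0Vmem F; first by rewrite cards0.
have u_inj : injective (fun j => (x.2 j).1).
  by move: w0F; rewrite inE; apply: traces_cycle_inj.
have := @card_agree _ (V * V)%type [set (x.2 j).1 | j : 'I_l] F.
rewrite card_imset // !card_ord card_prod; apply=> w w' + + i /imsetP[j _ ->].
rewrite !inE => /and3P[_ _ /forallP/(_ j)/eqP->].
by case/and3P=> [_ _ /forallP/(_ j)/eqP->].
Qed.

(** Each of the [(2 * D * (#|V| * #|V|)) ^ l] candidates occurs with probability at most 1 over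
    [(#|V| * #|V|) ^ l]; so the expected number of traces has a bound independent of [V]. *)
Lemma sum_card_traces_cycle (V : finType) D l :
  0 < #|V| ->
  \sum_x #|[set w : {ffun 'I_(D * #|V|) -> V * V} | @traces_cycle V _ l w x]|
    <= (2 * D) ^ l * (#|V| * #|V|) ^ (D * #|V|).
Proof.
move=> V_gt0; set M := D * #|V|.
have pos : 0 < (#|V| * #|V|) ^ l by rewrite expn_gt0 muln_gt0 V_gt0.
rewrite -(leq_pmul2r pos) big_distrl /=.
apply: leq_trans (leq_sum _ (fun x _ => card_traces_cycle x)) _.
rewrite sum_nat_const card_prod !card_ffun card_prod !card_ord card_bool.
rewrite -expnMn mulnAC -expnMn leq_mul2r; apply/orP; right.
by rewrite /M; move: #|V| => n; apply: eq_leq; congr (_ ^ _); lia.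
Qed.

Definition misses (V : finType) M (w : {ffun 'I_M -> V * V})
    (AB : {set V} * {set V}) : bool :=
  [forall i, w i \notin setX AB.1 AB.2].

(** A uniform pair falls into the product of the two sets with probability at least [1 / (L * L)],
    independently for the [M] terms. *)
Lemma card_misses (V : finType) M L (AB : {set V} * {set V}) :
  #|V| <= #|AB.1| * L -> #|V| <= #|AB.2| * L ->
  (L * L) ^ M * #|[set w : {ffun 'I_M -> V * V} | misses w AB]|
    <= (L * L).-1 ^ M * (#|V| * #|V|) ^ M.
Proof.
move=> A_ge B_ge.
have -> : #|[set w : {ffun 'I_M -> V * V} | misses w AB]|
        = #|~: setX AB.1 AB.2| ^ M.
  rewrite -[M in RHS]card_ord -card_ffun_on; apply: eq_card => w.
  rewrite inE; apply/forallP/ffun_onP => h i; first by rewrite inE h.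
  by have := h i; rewrite inE.
rewrite -!expnMn; case: M => [|M] //; rewrite leq_exp2r //.
have := leq_mul A_ge B_ge; rewrite [leqRHS]mulnACA.
have := cardsC (setX AB.1 AB.2); rewrite cardsX card_prod => <-.
case: (L * L) => [|Q] //=.
by move: (_ * _) #|~: _| => a b; nia.
Qed.

(** Bernoulli's inequality for [(1 + 1/q) ^ k], multiplied by [q ^ k.+1]. *)
Lemma bernoulli q k : (q + k) * q ^ k <= q * q.+1 ^ k.
Proof.
elim: k => [|k IH]; first by rewrite addn0.
rewrite !expnS; move: (q ^ k) (q.+1 ^ k) IH => a b; nia.
Qed.

(** Taking [k = 7 * q] in [bernoulli] gives [(1 + 1/q) ^ (7 * q) >= 8], the origin of the 7 in [D]
    below. *)
Lemma exp8_leq q n : 0 < q -> 8 ^ n * q ^ (7 * q * n) <= q.+1 ^ (7 * q * n).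
Proof.
move=> q_gt0; rewrite !(expnM _ _ n) -expnMn; case: n => // n; rewrite leq_exp2r //.
rewrite -(leq_pmul2l q_gt0); apply: leq_trans (bernoulli q (7 * q)).
by rewrite mulnA leq_mul2r; apply/orP; right; lia.
Qed.

(* With this D a fixed pair of large sets is missed with probability at most
   8^-|V|, which beats the 4^|V| choices of the pair. *)
Lemma sum_card_misses (V : finType) L D :
  D = 7 * (L * L).-1 -> 1 < L ->
  2 ^ #|V| * \sum_(AB : {set V} * {set V}
                  | (#|V| <= #|AB.1| * L) && (#|V| <= #|AB.2| * L))
    #|[set w : {ffun 'I_(D * #|V|) -> V * V} | misses w AB]|
    <= (#|V| * #|V|) ^ (D * #|V|).
Proof.
move=> defD L_gt1; set M := D * #|V|.
have pos : 0 < (L * L) ^ M by rewrite expn_gt0; nia.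
rewrite -(leq_pmul2l pos) mulnCA big_distrr /=.
have le (AB : {set V} * {set V}) (P : (#|V| <= #|AB.1| * L) && (#|V| <= #|AB.2| * L)) :=
  @card_misses V M L AB (proj1 (andP P)) (proj2 (andP P)).
apply: leq_trans (leq_mul (leqnn _) (leq_sum _ le)) _.
rewrite sum_nat_const mulnA mulnA leq_mul2r; apply/orP; right.
have Q_gt0 : 0 < (L * L).-1 by nia.
have := exp8_leq #|V| Q_gt0; rewrite prednK; last by nia.
rewrite -defD -/M; apply: leq_trans; rewrite leq_mul2r; apply/orP; right.
(* The factor 4 pays for the pairs of subsets; the spare 2 pays for [2 ^ #|V|]. *)
rewrite (_ : 8 = 2 * (2 * 2)) // !expnMn leq_mul2l; apply/orP; right.
apply: leq_trans (max_card _) _.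
by rewrite card_prod -cardsT -powersetT card_powerset cardsT.
Qed.

Lemma cycle_traced (V : finType) M (w : {ffun 'I_M -> V * V}) (s : seq V) :
  let e := [rel x y | [exists i, w i == (x, y)]] in
  graph_cycle [rel x y | e x y || e y x] s ->
  exists x : {ffun 'I_(size s) -> V} * {ffun 'I_(size s) -> 'I_M * bool},
    traces_cycle w x /\ forall j, x.1 j \in s.
Proof.
move=> e; case: s => // a s /andP[s_gt2 /andP[cyc s_uniq]].
pose l := size (a :: s); pose v := [ffun j : 'I_l => nth a (a :: s) j].
have step (j : 'I_l) : e (v j) (v (ordS j)) || e (v (ordS j)) (v j).
  move: cyc; rewrite /= => /(pathP a)/(_ j).
  rewrite size_rcons ltn_ord => /(_ isT); rewrite !ffunE /= -rcons_cons.
  rewrite nth_rcons ltn_ord nth_rcons /=.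
  have jl : j < (size s).+1 by [].
  (* The edge leaving the last entry returns to [a], where [ordS] wraps around. *)
  case: ltngtP => [js|js|js].
  - by rewrite modn_small.
  - by lia.
  by rewrite js modnn.
have /fin_all_exists[u uP] (j : 'I_l) : exists u : 'I_M * bool, w u.1 ==
    if u.2 then (v j, v (ordS j)) else (v (ordS j), v j).
  case/orP: (step j) => /existsP[i wi]; first by exists (i, true).
  by exists (i, false).
exists (v, finfun u); split; last by move=> j; rewrite ffunE mem_nth.
apply/and3P; split => //; last by apply/forallP => j; rewrite /= ffunE.
apply/injectiveP => i j; rewrite !ffunE => /eqP.
by rewrite nth_uniq // => /eqP/val_inj.
Qed.

(** Deletion method: [e] consists of the terms of a good sequence [w], and [X] takes one vertex from
    each trace of a short cycle. *)
Lemma sparse_graph g L n0 : 1 < L ->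
  exists n1, forall V : finType, n1 <= #|V| ->
  exists (e : rel V) (X : {set V}),
  [/\ #|X| * n0 <= #|V|,
      forall s, size s <= g -> graph_cycle [rel x y | e x y || e y x] s ->
        has (mem X) s
    & forall A B : {set V}, #|V| <= #|A| * L -> #|V| <= #|B| * L ->
        exists x y, [/\ x \in A, y \in B & e x y]].
Proof.
move=> L_gt1; pose D := 7 * (L * L).-1.
(* [C] bounds the mean number of traces of lengths 1 to [g]; the shift provides [ord0]. *)
pose C := \sum_(l < g) (2 * D) ^ l.+1.
(* The first summand absorbs up to [C.+1] deleted vertices, the second ensures [C.+2 < 2 ^ #|V|]. *)
exists (C.+1 * n0 + C.+2) => V V_ge.
have V_gt0 : 0 < #|V| by lia.
pose M := D * #|V|; pose W := {ffun 'I_M -> V * V}.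
pose big (AB : {set V} * {set V}) :=
  (#|V| <= #|AB.1| * L) && (#|V| <= #|AB.2| * L).
pose cyc (w : W) l : nat :=
  \sum_(x : {ffun 'I_l -> V} * {ffun 'I_l -> 'I_M * bool}) traces_cycle w x.
pose mis (w : W) : nat := \sum_(AB | big AB) misses w AB.
(* With weight [C.+2] on missed pairs, a total below [C.+2] leaves no missed pair and at most [C.+1]
   traces. *)
have [w] : exists w : W, \sum_(l < g) cyc w l.+1 + C.+2 * mis w < C.+2.
  apply: averaging; rewrite big_split /= -big_distrr /= exchange_big /=.
  rewrite card_ffun card_prod card_ord.
  set N := (_ * _) ^ M; have N_gt0 : 0 < N by rewrite expn_gt0 muln_gt0 V_gt0.
  rewrite -[ltnRHS]/(N + (N + C * N)) addnA [ltnRHS]addnC -addnS leq_add //.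
    rewrite /C big_distrl; apply: leq_sum => l _.
    by rewrite double_count; apply: sum_card_traces_cycle.
  have := @sum_card_misses V L D erefl L_gt1; rewrite double_count.
  move: (\sum_(_ | _) _) => S S_le.
  have : C.+2 < 2 ^ #|V| by apply: leq_ltn_trans (ltn_expl _ _) => //; lia.
  have {}S_le : 2 ^ #|V| * S <= N := S_le.
  move: (2 ^ #|V|) S_le => K S_le K_gt.
  have : C.+2 * S <= K * S by rewrite leq_mul2r; lia.
  by move: (C.+2 * S) (K * S) S_le; lia.
rewrite -[ltnRHS]addn0 => W_lt.
have /eqP : mis w = 0 by nia.
rewrite sum_nat_eq0 => /forallP mis0.
pose X := \bigcup_(l < g) [set x.1 ord0 | x :
  {ffun 'I_l.+1 -> V} * {ffun 'I_l.+1 -> 'I_M * bool} & traces_cycle w x].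
exists [rel x y | [exists i, w i == (x, y)]], X; split.
- have : #|X| <= \sum_(l < g) cyc w l.+1; last first.
    by move: V_ge W_lt => /=; nia.
  apply: (big_ind2 (fun (A : {set V}) a => #|A| <= a)) => [|A a B b Aa Bb|l _].
  + by rewrite cards0.
  + by rewrite (leq_trans (leq_card_setU _ _)) ?leq_add.
  apply: leq_trans (leq_imset_card _ _) _; rewrite -sum1_card big_mkcond.
  by apply: leq_sum => x _; rewrite inE; case: (traces_cycle w x).
- case=> [|a s] // s_le /cycle_traced[x [wx xs]]; apply/hasP.
  exists (x.1 ord0) => //; apply/bigcupP; exists (Ordinal s_le) => //.
  by apply/imsetP; exists x; rewrite ?inE.
move=> A B A_ge B_ge; have := mis0 (A, B).
rewrite /big A_ge B_ge eqb0 => /forallPn[i]; rewrite negbK.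
case wi : (w i) => [x y] /setXP[xA yB]; exists x, y; split=> //.
by apply/existsP; exists i; rewrite wi.
Qed.

(** * Layered digraphs, their components and homomorphisms *)

Definition induced (H : digraph) (S : {set H}) : digraph :=
  @Digraph {x : H | x \in S} [rel x y | arc (val x) (val y)].

(** This amounts to a homomorphism to the transitive tournament of order [p]; it yields acyclicity
    and the bound on [maxpath] together. *)
Definition layered (p : nat) (H : digraph) : Prop :=
  exists2 lev : H -> nat, forall x, lev x < p
                        & forall x y, arc x y -> lev x < lev y.

Definition no_short_cycle (g : nat) (H : digraph) : Prop :=
  forall s : seq H, size s <= g -> ~~ graph_cycle (@und H) s.

Lemma graph_cycle_map (T U : finType) (e : rel T) (e' : rel U) (h : T -> U) s :
  injective h -> {homo h : x y / e x y >-> e' x y} ->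
  graph_cycle e s -> graph_cycle e' (map h s).
Proof.
move=> h_inj h_homo /andP[s_gt2 /andP[cyc s_uniq]].
by rewrite /graph_cycle size_map s_gt2 /ucycleb map_inj_uniq // (homo_cycle h_homo).
Qed.

Lemma homo_und (H G : digraph) (h : H -> G) :
  homomorphism h -> {homo h : x y / und x y >-> und x y}.
Proof. by move=> hP x y /orP[] /hP xy; apply/orP; [left | right]. Qed.

Lemma layered_homo p (H G : digraph) (h : H -> G) :
  homomorphism h -> layered p G -> layered p H.
Proof.
move=> hP [lev lev_lt levP]; exists (lev \o h) => [x|x y /hP /levP //].
exact: lev_lt.
Qed.

Lemma no_short_cycle_homo g (H G : digraph) (h : H -> G) :
  injective h -> homomorphism h -> no_short_cycle g G -> no_short_cycle g H.
Proof.
move=> h_inj hP nsc s s_le; apply: contra (nsc (map h s) _).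
  exact/graph_cycle_map/homo_und.
by rewrite size_map.
Qed.

(** Outside [S] the extension takes an arbitrary default value, hence the nonempty [T]. *)
Lemma induced_extend (H T : digraph) (S : {set H}) (f : induced S -> T) :
  0 < #|T| -> homomorphism f ->
  exists F : H -> T, forall x y, x \in S -> y \in S -> arc x y -> arc (F x) (F y).
Proof.
move=> /card_gt0P[t _] fP.
exists (fun x => if insub x is Some u then f u else t) => x y xS yS xy.
by rewrite !insubT; apply: fP.
Qed.

Lemma und_sym (H : digraph) : symmetric (@und H).
Proof. by move=> x y; rewrite /und /= orbC. Qed.

(** A path starting in a component never leaves it, so it lifts vertex by vertex. *)
Lemma component_connected (H : digraph) (r : H) :
  connected (induced [set x | connect (@und H) r x]).
Proof.
set S := [set x | _]; set K := induced S.
have lift x (xS : x \in S) p (px : path (@und H) x p) (yS : last x p \in S) :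
    connect (@und K) (Sub x xS) (Sub (last x p) yS).
  elim: p x xS px yS => [|y p IH] x xS /=.
    by move=> _ yS; rewrite (bool_irrelevance yS xS).
  case/andP=> xy py zS.
  have yS : y \in S.
    by move: xS; rewrite !inE => /connect_trans; apply; apply: connect1.
  by apply: connect_trans (IH y yS py zS); apply: connect1.
case=> x xS [y yS]; have : connect (@und H) x y.
  move: (xS) (yS); rewrite !inE => rx; apply: connect_trans.
  by rewrite (sym_connect_sym (@und_sym H)).
by case/connectP=> p px defy; subst y; apply: lift.
Qed.

(** Homomorphisms of the components glue: each vertex uses the map chosen for its canonical root,
    and the ends of an arc share that root. *)
Lemma component_homo (H T : digraph) : 0 < #|T| ->
  (forall f : H -> T, ~ homomorphism f) ->
  exists r : H, forall f : induced [set x | connect (@und H) r x] -> T,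
    ~ homomorphism f.
Proof.
move=> T_gt0 noF; apply: contrapT => noR.
have /fin_all_exists[F FP] (r : H) : exists F : H -> T, forall x y,
    connect (@und H) r x -> connect (@und H) r y -> arc x y -> arc (F x) (F y).
  have [f fP] : exists f : induced [set x | connect (@und H) r x] -> T,
      homomorphism f.
    apply: contrapT => noE; apply: noR; exists r => f fP.
    by apply: noE; exists f.
  have [F FP] := induced_extend T_gt0 fP; exists F => x y rx ry.
  by apply: FP; rewrite inE.
case: (noF (fun x => F (fingraph.root (@und H) x) x)) => x y xy.
have csym : connect_sym (@und H) := sym_connect_sym (@und_sym H).
have cxy : connect (@und H) x y by apply: connect1; rewrite /und /= xy.
rewrite -(fingraph.rootP csym cxy).
have rx : connect (@und H) (fingraph.root (@und H) x) x.
  by rewrite csym connect_root.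
by apply: FP => //; apply: connect_trans cxy.
Qed.

Lemma layered_not_homomorphic g p (T : digraph) :
  0 < #|T| ->
  (forall t : 'I_p -> T, ~ forall i j : 'I_p, i < j -> arc (t i) (t j)) ->
  exists H : digraph,
    [/\ connected H, layered p H, no_short_cycle g H
      & forall f : H -> T, ~ homomorphism f].
Proof.
move=> T_gt0 noT.
(* For no levels [noT] is absurd, its condition being vacuous. *)
case: p noT => [|p] noT.
  by have /card_gt0P[t _] := T_gt0; case: (noT (fun=> t)) => -[].
(* Deletions cost at most half of a level, a level is [1 / p.+1] of [V], and a popular value keeps
   [1 / #|T|] of the rest; the product of these shares is the density required. *)
have [|n1 sparse] := @sparse_graph g (2 * #|T| * p.+1) (2 * p.+1); first by nia.
pose V := ('I_p.+1 * 'I_n1.+1)%type.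
have cardV : #|{: V}| = p.+1 * n1.+1 by rewrite card_prod !card_ord.
have [|e [X [X_le X_cyc X_arc]]] := sparse V; first by rewrite cardV; lia.
pose G := @Digraph V [rel x y : V | (x.1 < y.1) && e x y].
pose K := @induced G (~: X).
have K_layered : layered p.+1 K.
  exists (fun x : K => nat_of_ord (val x).1) => [x|x y]; first exact: ltn_ord.
  by case/andP.
have K_cycle : no_short_cycle g K.
  move=> s s_le; apply/negP => /(@graph_cycle_map _ _ _ [rel x y | e x y || e y x] val).
  move=> /(_ val_inj) cyc.
  have /hasP[_ /mapP[u _ ->]] : has (mem X) (map val s).
    apply: X_cyc; rewrite ?size_map //; apply: cyc => x y.
    by case/orP=> /andP[_ /= ->]; rewrite ?orbT.
  by have := valP u; rewrite inE => /negP.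
have K_noT (f : K -> T) : ~ homomorphism f.
  move=> /(induced_extend T_gt0)[F FP].
  pose lvl i : {set V} := [set x : V | x.1 == i] :\: X.
  have /fin_all_exists[t tP] (i : 'I_p.+1) := pigeonhole F (lvl i) T_gt0.
  have big i : #|{: V}| <= #|[set x in lvl i | F x == t i]| * (2 * #|T| * p.+1).
    have : n1.+1 <= #|lvl i| + #|X|.
      have row : #|[set ((i, u) : V) | u : 'I_n1.+1]| = n1.+1.
        by rewrite card_imset ?card_ord // => u v [].
      apply: leq_trans (eq_leq (esym row)) _.
      apply: leq_trans (leq_card_setU _ _); apply/subset_leq_card/subsetP.
      by move=> _ /imsetP[u _ ->]; rewrite !inE /= eqxx andbT orbC orbN.
    have X_le2 : #|X| * 2 <= n1.+1.
      by rewrite -(leq_pmul2l (ltn0Sn p)) mulnCA (mulnC p.+1 2) -cardV.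
    have := tP i; rewrite cardV (mulnC (2 * _)) mulnCA leq_pmul2l //.
    move: X_le2; move: #|T| #|X| #|lvl i| #|[set _ in lvl i | _]| => a b c d; lia.
  apply: (noT t) => i j ij.
  have [x [y [+ + xy]]] := X_arc _ _ (big i) (big j).
  rewrite !inE => /andP[/andP[xX /eqP xi] /eqP <-] /andP[/andP[yX /eqP yj] /eqP <-].
  by apply: FP; rewrite ?inE //= xi yj ij.
have [r rP] := component_homo T_gt0 K_noT.
pose C := induced [set x | connect (@und K) r x].
have C_homo : @homomorphism C K val by [].
exists C; split=> //; first exact: component_connected.
  exact: layered_homo C_homo K_layered.
by apply: (@no_short_cycle_homo _ C K val) => //; apply: val_inj.
Qed.

(** * Acyclicity, path length, girth and forbidden subgraphs *)

Lemma path_layered_uniq (H : digraph) (lev : H -> nat) (x : H) (s : seq H) :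
  (forall x y, arc x y -> lev x < lev y) -> path (@arc H) x s ->
  uniq (map lev (x :: s)).
Proof.
move=> levP xs; apply: (sorted_uniq ltn_trans ltnn).
by rewrite sorted_map /=; apply: sub_path xs.
Qed.

Lemma layered_acyclic_oriented p (H : digraph) : layered p H -> acyclic_oriented H.
Proof.
case=> lev _ levP; split.
  apply/andP; split; apply/forallP => x; first by apply/negP => /levP; lia.
  apply/forallP => y; apply/implyP => /levP xy; apply/negP => /levP; lia.
(* A directed cycle is a path back to [x], on which the level of [x] would occur twice. *)
case=> // x s /andP[/(path_layered_uniq levP)].
by rewrite map_cons map_rcons /= mem_rcons inE eqxx.
Qed.

Lemma layered_maxpath p (H : digraph) : layered p H -> maxpath H <= p.
Proof.
case=> lev lev_lt levP; apply/bigmax_leqP => n /existsP[[s /= /eqP <-]].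
case: s => // x s /andP[_ /(path_layered_uniq levP) lev_uniq].
rewrite -(size_map lev) -[p](size_iota 0); apply: uniq_leq_size => // i.
by case/mapP=> y _ ->; rewrite mem_iota /= add0n.
Qed.

Lemma no_short_cycle_girth g (H : digraph) :
  no_short_cycle g H -> girth_gt (@und H) g.
Proof.
rewrite /girth_gt /girth => nsc.
set r := [seq _ <- _ | _]; case def_r : r => [|n r'] //=.
have : n \in r by rewrite def_r mem_head.
rewrite mem_filter => /andP[/existsP[s s_cyc] _]; rewrite ltnNge.
by apply: contraL s_cyc => n_le; rewrite nsc // size_tuple.
Qed.

(** A copy of [F] would carry its cycle to one in [H] with the same number of vertices, at most
    [#|F|]. *)
Lemma no_short_cycle_free (F H : digraph) (s : seq F) :
  graph_cycle (@und F) s -> no_short_cycle #|F| H -> free F H.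
Proof.
move=> s_cyc nsc S A /forall_inP sub [f [f_bij f_arc]].
have : graph_cycle (@und H) (map (val \o f) s).
  apply: graph_cycle_map s_cyc => [|x y]; first exact/inj_comp/bij_inj/f_bij/val_inj.
  rewrite /und /= -!f_arc => /orP[] /sub /and3P[/= -> _ _] //.
  by rewrite orbT.
apply/negP/nsc; rewrite size_map.
have /andP[_ /andP[_ /card_uniqP <-]] := s_cyc; exact: max_card.
Qed.

(** * Oriented cliques at girth above six *)

Section Cliques.
Variables (H : digraph) (lev : H -> nat).
Hypothesis levP : forall x y, arc x y -> lev x < lev y.
Hypothesis nsc : no_short_cycle 6 H.

Lemma arc_und : subrel (@arc H) (@und H).
Proof. by move=> x y; rewrite /und /= => ->. Qed.

(** The chord would close the path to a cycle with 3 to 6 vertices. *)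
Lemma no_chord x s :
  path (@arc H) x s -> 1 < size s <= 5 -> ~~ arc x (last x s).
Proof.
move=> xs /andP[s_gt1 s_le]; apply/negP => x_last.
have /negP[] := @nsc (x :: s) s_le; rewrite /graph_cycle /= ltnS s_gt1.
rewrite /ucycleb /= rcons_path (sub_path arc_und) //=.
by rewrite /und /= x_last orbT -cons_uniq (map_uniq (path_layered_uniq levP xs)).
Qed.

(** A detour through a new vertex [z] would close a cycle with [size s + 2 <= 6] vertices. *)
Lemma bypass x s z :
  path (@arc H) x s -> 1 < size s <= 4 -> arc x z -> arc z (last x s) -> z \in s.
Proof.
move=> xs /andP[s_gt1 s_le] xz z_last; apply: contraT => zs.
have /negP[] := @nsc (z :: x :: s) s_le; rewrite /graph_cycle /= !ltnS ltnW //.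
rewrite /ucycleb /= rcons_path (sub_path arc_und) //= /und /= xz z_last !orbT /=.
have /= -> := map_uniq (path_layered_uniq levP xs).
rewrite inE negb_or zs !andbT.
by apply: contraTneq xz => ->; apply/negP => /levP; rewrite ltnn.
Qed.

Definition up_linked (x y : H) : Prop :=
  arc x y \/ exists z, arc x z /\ arc z y.

(** A directed path from [y] to [x] would make the level of [x] strictly larger. *)
Lemma linkedP x y : linked x y -> lev x <= lev y -> up_linked x y.
Proof.
case/or4P => [xy|/levP|/existsP[z /andP[xz zy]]|/existsP[z /andP[/levP yz /levP zx]]].
- by left.
- lia.
- by right; exists z.
- lia.
Qed.

(* Two different directed paths from x to z of lengths at most 4 and 2 would form
   a cycle of length at most 6, so the path through y is x -> y -> z itself. *)
Lemma up_linked_triple x y z : up_linked x y -> up_linked y z -> up_linked x z ->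
  [/\ arc x y, arc y z & ~~ arc x z].
Proof.
have irr (u : H) : ~~ arc u u by apply/negP => /levP; rewrite ltnn.
case=> [xy | [a [xa ay]]] [yz | [b [yb bz]]] xz.
- have nxz : ~~ arc x z by apply: (@no_chord x [:: y; z]); rewrite //= xy yz.
  by split.
- have nxz : ~~ arc x z.
    by apply: (@no_chord x [:: y; b; z]); rewrite //= xy yb bz.
  case: xz => [xz | [c [xc cz]]]; first by rewrite xz in nxz.
  (* [c] can only be [y], [b] or [z]: the first two give a chord, the last a loop. *)
  have := @bypass x [:: y; b; z] c; rewrite /= xy yb bz xc cz => /(_ isT isT isT isT).
  rewrite !inE => /or3P[] /eqP def_c; subst c.
  + by have := @no_chord y [:: b; z]; rewrite /= yb bz cz => /(_ isT isT).
  + by have := @no_chord x [:: y; b]; rewrite /= xy yb xc => /(_ isT isT).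
  + by rewrite (negPf (irr _)) in cz.
- have nxz : ~~ arc x z.
    by apply: (@no_chord x [:: a; y; z]); rewrite //= xa ay yz.
  case: xz => [xz | [c [xc cz]]]; first by rewrite xz in nxz.
  have := @bypass x [:: a; y; z] c; rewrite /= xa ay yz xc cz => /(_ isT isT isT isT).
  rewrite !inE => /or3P[] /eqP def_c; subst c.
  + by have := @no_chord a [:: y; z]; rewrite /= ay yz cz => /(_ isT isT).
  + by have := @no_chord x [:: a; y]; rewrite /= xa ay xc => /(_ isT isT).
  + by rewrite (negPf (irr _)) in cz.
have nxz : ~~ arc x z.
  by apply: (@no_chord x [:: a; y; b; z]); rewrite //= xa ay yb bz.
case: xz => [xz | [c [xc cz]]]; first by rewrite xz in nxz.
have := @bypass x [:: a; y; b; z] c; rewrite /= xa ay yb bz xc cz => /(_ isT isT isT isT).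
rewrite !inE => /or4P[] /eqP def_c; subst c.
- by have := @no_chord a [:: y; b; z]; rewrite /= ay yb bz cz => /(_ isT isT).
- by have := @no_chord x [:: a; y]; rewrite /= xa ay xc => /(_ isT isT).
- by have := @no_chord x [:: a; y; b]; rewrite /= xa ay yb xc => /(_ isT isT).
- by rewrite (negPf (irr _)) in cz.
Qed.

(** Of four members sorted by level, [x2, x3, x4] forbid an arc from [x2] to [x4], while
    [x1, x2, x4] require it. *)
Lemma omega_ro_leq3 : omega_ro H <= 3.
Proof.
apply/bigmax_leqP => S /forall_inP S_clique; rewrite leqNgt; apply/negP.
pose le := relpre lev leq; pose s := sort le (enum S).
have s_sorted : pairwise le s.
  rewrite -sorted_pairwise; last by move=> u v w; apply: leq_trans.
  by apply: sort_sorted => u v; apply: leq_total.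
have s_uniq : pairwise [rel x y | x != y] s by rewrite -uniq_pairwise sort_uniq enum_uniq.
have s_in x : x \in s -> x \in S by rewrite mem_sort mem_enum.
rewrite cardE -(size_sort le) -/s; case: s s_sorted s_uniq s_in => [|x1 [|x2 [|x3 [|x4 s]]]] //=.
move=> le_s neq_s in_s _.
have up x y : x \in S -> y \in S -> x != y -> le x y -> up_linked x y.
  move=> xS yS xy le_xy; apply: linkedP => //.
  by have /forall_inP/(_ y yS)/implyP := S_clique x xS; apply.
have [S1 S2 S3 S4] : [/\ x1 \in S, x2 \in S, x3 \in S & x4 \in S].
  by split; apply: in_s; rewrite !inE eqxx ?orbT.
move: le_s neq_s => /and5P[/and4P[l12 l13 l14 _] /and3P[l23 l24 _] /andP[l34 _] _ _].
move=> /and5P[/and4P[n12 n13 n14 _] /and3P[n23 n24 _] /andP[n34 _] _ _].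
have [_ _ /negP[]] := up_linked_triple (up _ _ S2 S3 n23 l23) (up _ _ S3 S4 n34 l34)
  (up _ _ S2 S4 n24 l24).
by have [] := up_linked_triple (up _ _ S1 S2 n12 l12) (up _ _ S2 S4 n24 l24)
  (up _ _ S1 S4 n14 l14).
Qed.

End Cliques.

(** The linking paths of a subgraph are also paths of [H]. *)
Lemma omega_ao_leq_ro (H : digraph) : omega_ao H <= omega_ro H.
Proof.
apply/bigmax_leqP => S /existsP[A /andP[/forall_inP sub /andP[_ /forallP clq]]].
apply: leq_bigmax_cond; apply/forall_inP => x xS; apply/forall_inP => y yS.
apply/implyP => xy.
have arcP u v : @arc (subdigraph S A) u v -> arc (val u) (val v).
  by move=> /sub /and3P[].
have /forallP/(_ (Sub y yS))/implyP/(_ xy) := clq (Sub x xS).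
case/or4P => [/arcP|/arcP|/existsP[z /andP[/arcP a /arcP b]]
             |/existsP[z /andP[/arcP a /arcP b]]].
- by move=> a; apply/or4P; constructor 1.
- by move=> a; apply/or4P; constructor 2.
- by apply/or4P; constructor 3; apply/existsP; exists (val z); rewrite a.
- by apply/or4P; constructor 4; apply/existsP; exists (val z); rewrite a.
Qed.

Lemma layered_class_R p k (H : digraph) :
  3 <= k -> layered p H -> no_short_cycle 6 H -> class_R k H.
Proof.
move=> k_ge3 layH nsc; split; first exact: layered_acyclic_oriented layH.
by have [lev _ levP] := layH; apply: leq_trans (omega_ro_leq3 levP nsc) k_ge3.
Qed.

Lemma class_R_A k (H : digraph) : class_R k H -> class_A k H.
Proof. by case=> ? ?; split=> //; apply: leq_trans (omega_ao_leq_ro H) _. Qed.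

(** * Existence of the compressibility and its lower bound *)

(** The out- or the in-neighbourhood of any [x] in [S] keeps [2 ^ p] of at least [2 ^ p.+1]
    vertices; [x] is put before the sequence found there, or after it. *)
Lemma transitive_subtournament (T : digraph) p (S : {set T}) :
  tournament T -> 2 ^ p <= #|S| ->
  exists s : seq T, [/\ size s = p, pairwise (@arc T) s & {subset s <= S}].
Proof.
move=> /andP[/forallP irr /forallP tot]; elim: p S => [|p IH] S S_ge.
  by exists [::].
have [S0 | [x xS]] := set_0Vmem S; first by move: S_ge; rewrite S0 cards0 leqn0 expn_eq0.
pose Out := [set y in S | arc x y]; pose In := [set y in S | arc y x].
have cover : #|S :\ x| <= #|Out| + #|In|.
  apply: leq_trans (leq_card_setU _ _); apply/subset_leq_card/subsetP => y.
  rewrite !inE => /andP[yx yS]; rewrite yS /=.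
  have /forallP/(_ y)/implyP := tot x; rewrite eq_sym => /(_ yx).
  by case: (arc x y).
have card_S : #|S| = #|S :\ x|.+1 by rewrite (cardsD1 x S) xS.
have [Out_ge | In_ge] : 2 ^ p <= #|Out| \/ 2 ^ p <= #|In|.
  by move: S_ge; rewrite expnS; lia.
- have [s [s_size s_pw sS]] := IH _ Out_ge; exists (x :: s); split.
  + by rewrite /= s_size.
  + rewrite /= s_pw andbT; apply/allP => y /sS.
    by rewrite inE => /andP[].
  + by move=> y /predU1P[-> // | /sS]; rewrite inE => /andP[].
have [s [s_size s_pw sS]] := IH _ In_ge; exists (rcons s x); split.
- by rewrite size_rcons s_size.
- rewrite pairwise_rcons s_pw andbT; apply/allP => y /sS.
  by rewrite inE => /andP[].
- move=> y; rewrite mem_rcons => /predU1P[-> // | /sS].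
  by rewrite inE => /andP[].
Qed.

Lemma layered_maps_to_tournaments p (H : digraph) :
  layered p H -> maps_to_tournaments H (2 ^ p).
Proof.
case=> lev lev_lt levP T tourT cardT.
have [t _] : exists t : T, t \in T by apply/card_gt0P; rewrite cardT expn_gt0.
have [|s [s_size /(pairwiseP t) sP _]] := @transitive_subtournament T p setT tourT.
  by rewrite cardsT cardT.
exists (fun x => nth t s (lev x)) => x y /levP xy.
by apply: sP; rewrite // inE s_size.
Qed.

(** A bound on all [n] with [is_compressibility H n] can only be violated if such an [n] exists. *)
Lemma compressibility_exists p (H : digraph) :
  layered p H -> exists n, is_compressibility H n.
Proof.
move=> /layered_maps_to_tournaments Hp.
have ex : exists n, (0 < n) && `[< maps_to_tournaments H n >].
  by exists (2 ^ p); rewrite expn_gt0; apply/asboolP.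
exists (ex_minn ex); case: ex_minnP => n /andP[n_gt0 /asboolP Hn] n_min.
by split=> // m m_gt0 Hm; apply: n_min; rewrite m_gt0; apply/asboolP.
Qed.

Lemma induced_tournament (T : digraph) (S : {set T}) :
  tournament T -> tournament (induced S).
Proof.
move=> /andP[/forallP irr /forallP tot]; apply/andP; split; apply/forallP => x.
  exact: irr.
by apply/forallP => y; have /forallP/(_ (val y)) := tot (val x).
Qed.

(** If [n <= #|T|], a homomorphism to a subtournament on [n] vertices of [T] would be one to [T]. *)
Lemma compressibility_gt (H T : digraph) n :
  tournament T -> (forall f : H -> T, ~ homomorphism f) ->
  is_compressibility H n -> #|T| < n.
Proof.
move=> tourT noT [_ Hn _]; rewrite ltnNge; apply/negP => n_le.
pose S := [set x in take n (enum T)].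
have cardS : #|S| = n.
  rewrite cardsE (card_uniqP _) ?take_uniq ?enum_uniq //.
  by rewrite size_takel // -cardE.
have [||f fP] := Hn (induced S); first exact: induced_tournament.
  by rewrite card_sig.
by case: (noT (val \o f)) => x y /fP.
Qed.

(** * Refutation of polynomial bounds *)

Lemma exp_beats_poly c d : exists q, c * q.+1.*2 ^ d <= 2 ^ q.
Proof.
(* Making [q.+1] a power of two reduces the claim to exponents: [c + (2 * m).+1 * d < m.+1 ^ 2 <= 2
   ^ (2 * m)]. *)
pose m := 2 * d + c + 1; exists (2 ^ (2 * m)).-1.
rewrite prednK ?expn_gt0 // -mul2n -expnS -expnM.
apply: leq_trans (leq_mul (ltnW (@ltn_expl 2 c isT)) (leqnn _)) _.
rewrite -expnD leq_exp2l //.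
have m2_le : m.+1 ^ 2 <= 2 ^ (2 * m).
  by rewrite mulnC expnM leq_exp2r // ltn_expl.
have : c + (2 * m).+1 * d < m.+1 ^ 2; last by lia.
rewrite /m; nia.
Qed.

Lemma not_poly_tau_bounded (R : realType) (C : digraph -> Prop) :
  (forall q, exists H T : digraph, [/\ C H, layered q.+1.*2 H, tournament T,
     #|T| = 2 ^ q & forall f : H -> T, ~ homomorphism f]) ->
  ~ poly_tau_bounded R C.
Proof.
move=> unb [c [d [c_gt0 d_gt0 bound]]].
have c_lt := archi_boundP (ltW c_gt0); have d_lt := archi_boundP (ltW d_gt0).
move: (Num.bound c) (Num.bound d) c_lt d_lt => c' d' c_lt d_lt.
have [q q_big] := exp_beats_poly c' d'.
have [H [T [CH layH tourT cardT noT]]] := unb q.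
have [n n_tau] := compressibility_exists layH.
have n_gt := compressibility_gt tourT noT n_tau.
(* An empty [H] would map to [T]. *)
have H_gt0 : 0 < #|H|.
  rewrite lt0n; apply/negP => /eqP/card0_eq H0.
  have /card_gt0P[t _] : 0 < #|T| by rewrite cardT expn_gt0.
  by case: (noT (fun=> t)) => x; have := H0 x.
have := bound H CH H_gt0 n n_tau; apply/negP; rewrite -ltNge.
(* The real constants are raised to the naturals [c'] and [d']; enlarging the exponent is sound
   since the base [q.+1.*2] is at least 1. *)
apply: (@le_lt_trans _ _ (2 ^ q)%:R%R); last by rewrite ltr_nat -cardT.
apply: (@le_trans _ _ (c' * q.+1.*2 ^ d')%:R%R); last by rewrite ler_nat.
rewrite natrM natrX; apply: ler_pM; rewrite ?powR_ge0 ?(ltW c_gt0) ?(ltW c_lt) //.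
rewrite -powR_mulrn ?ler0n //.
apply: (@le_trans _ _ (powR q.+1.*2%:R d)%R).
  by rewrite ge0_ler_powR ?(ltW d_gt0) ?nnegrE ?ler_nat ?layered_maxpath.
by rewrite ler_powR ?(ltW d_lt) // ler1n.
Qed.

Lemma layered_witness (g q : nat) : exists H T : digraph,
  [/\ connected H, no_short_cycle g H & [/\ layered q.+1.*2 H, tournament T,
     #|T| = 2 ^ q & forall f : H -> T, ~ homomorphism f]].
Proof.
have [T [tourT cardT noT]] := tournament_without_transitive q.
have [|H [H_conn layH nsc noH]] := @layered_not_homomorphic g _ T _ noT.
  by rewrite cardT expn_gt0.
by exists H, T.
Qed.

Lemma no_short_cycle_leq g g' (H : digraph) :
  g <= g' -> no_short_cycle g' H -> no_short_cycle g H.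
Proof. by move=> gg' nsc s s_le; apply: nsc; apply: leq_trans gg'. Qed.

Theorem corollary1p2 (R : realType) :
  (forall k : nat, 3 <= k ->
     ~ poly_tau_bounded R (class_A k) /\ ~ poly_tau_bounded R (class_R k)) /\
  (forall k g : nat, 3 <= k -> 1 <= g ->
     ~ poly_tau_bounded R (connected_girth_gt g (class_A k)) /\
     ~ poly_tau_bounded R (connected_girth_gt g (class_R k))) /\
  (forall F : digraph, acyclic_oriented F ->
     (exists s : seq F, graph_cycle (@und F) s) ->
     ~ poly_tau_bounded R (free_class F)).
Proof.
(* One family of witnesses serves all the classes; only the length [g] of excluded cycles varies. *)
have reduce g (C : digraph -> Prop) :
    (forall p H, layered p H -> connected H -> no_short_cycle g H -> C H) ->
    ~ poly_tau_bounded R C.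
  move=> CP; apply: not_poly_tau_bounded => q.
  have [H [T [H_conn nsc [layH tourT cardT noT]]]] := layered_witness g q.
  by exists H, T; split=> //; apply: CP layH H_conn nsc.
split=> [k k_ge3|].
  split; apply: (reduce 6) => p H layH _ nsc; first apply: class_R_A.
    exact: layered_class_R layH nsc.
  exact: layered_class_R layH nsc.
split=> [k g k_ge3 _|F _ [s s_cyc]].
  (* Excluding cycles up to [maxn g 6] secures both the girth and the clique bound. *)
  have CR p H : layered p H -> no_short_cycle (maxn g 6) H -> class_R k H.
    move=> layH nsc; apply: layered_class_R layH _ => //.
    exact: no_short_cycle_leq (leq_maxr g 6) nsc.
  have girthP H : no_short_cycle (maxn g 6) H -> girth_gt (@und H) g.
    by move=> nsc; apply/no_short_cycle_girth/(no_short_cycle_leq (leq_maxl g 6)).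
  split; apply: (reduce (maxn g 6)) => p H layH H_conn nsc.
    by split; [exact/class_R_A/(CR p) | | exact: girthP].
  by split; [exact: CR layH nsc | | exact: girthP].
apply: (reduce #|F|) => p H layH _ nsc; split.
  exact: layered_acyclic_oriented layH.
exact: no_short_cycle_free s_cyc nsc.
Qed.
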